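(* Let $H$ be an $\ell$-graph with $e(H)\ge 2$ and let $\epsilon>0$. For some $c>0$ and for every $N\ge c$, there exists a collection $\mathcal{C}$ of $\ell$-graphs on vertex set $[N]$ such that (a) for every $H$-free $\ell$-graph $I$ on vertex set $[N]$, there exists $C\in\mathcal{C}$ with $I\subset C$; (b) for every $\ell$-graph $C\in\mathcal{C}$, the number of copies of $H$ in $C$ is at most $\epsilon N^{v(H)}$, and $e(C)\le(\pi(H)+\epsilon)\binom{N}{\ell}$; (c) $\log|\mathcal{C}|\le c\,N^{\ell-1/m(H)}\log N$; (d) moreover, for every $I$ in (a), there exists $T=(T_1,\ldots,T_s)$, where $T_i\subset I$, $s\le c$ and $\sum_i e(T_i)\le c\,N^{\ell-1/m(H)}$, such that $C=C(T)$; that is, the container $C$ in (a) is a function of (is determined by) the tuple $T$ alone.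
   Context: An $\ell$-graph is an $\ell$-uniform hypergraph; $v(\cdot)$ and $e(\cdot)$ denote numbers of vertices and edges, and $[N]=\{1,\ldots,N\}$. The symbol $\subset$ between $\ell$-graphs on $[N]$ means ''is a subgraph of''. An $\ell$-graph is $H$-free if it contains no subgraph isomorphic to $H$; a copy of $H$ in $C$ is a subgraph of $C$ isomorphic to $H$. For an $\ell$-graph $H$ with $e(H)\ge2$, $$m(H)=\max_{H'\subset H,\ e(H')>1}\frac{e(H')-1}{v(H')-\ell}.$$ $\mathrm{ex}(N,H)$ is the maximum number of edges in an $H$-free $\ell$-graph on $N$ vertices, and $\pi(H)=\lim_{N\to\infty}\mathrm{ex}(N,H)\binom{N}{\ell}^{-1}$. In (d), the notation $C=C(T)$ means that there is a fixed function (depending on $H,\epsilon,N$ but not on $I$) from tuples $T$ of $\ell$-graphs on $[N]$ to $\ell$-graphs on $[N]$, whose value at $T$ is the container $C\in\mathcal C$ of $I$. *)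

(* Defs.v *)
From HB Require Import structures.
From mathcomp Require Import all_boot.
Set Implicit Arguments.
Unset Strict Implicit.
Unset Printing Implicit Defensive.

(* An l-graph is a pair (vertex set, edge set) inside an ambient finType [T].
   Carrying the vertex set lets subgraphs and copies be l-graphs themselves,
   possibly with isolated vertices. *)
Record lgraph (l : nat) (T : finType) := LGraph {
  lgraph_val :> {set T} * {set {set T}};
  lgraph_valP :
    [forall e in lgraph_val.2, (e \subset lgraph_val.1) && (#|e| == l)] }.

HB.instance Definition _ l T := [isSub for @lgraph_val l T].
HB.instance Definition _ l T := [Finite of lgraph l T by <:].

Definition vset l (T : finType) (G : lgraph l T) : {set T} :=
  (lgraph_val G).1.
Definition eset l (T : finType) (G : lgraph l T) : {set {set T}} :=
  (lgraph_val G).2.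
Definition nv l (T : finType) (G : lgraph l T) : nat := #|vset G|.
Definition ne l (T : finType) (G : lgraph l T) : nat := #|eset G|.

Definition subgraph l (T : finType) (G G' : lgraph l T) : bool :=
  (vset G \subset vset G') && (eset G \subset eset G').

Definition isomorphic l (T T' : finType) (G : lgraph l T) (G' : lgraph l T') :
    bool :=
  [exists f : {ffun {x : T | x \in vset G} -> T'},
    [&& injectiveb f,
        [set f x | x : {x : T | x \in vset G}] == vset G' &
        [set [set f x | x : {x : T | x \in vset G} & val x \in e]
           | e : {set T} in eset G] == eset G']].

Definition copies l (T T' : finType) (H : lgraph l T) (G : lgraph l T') :
    {set lgraph l T'} :=
  [set G' : lgraph l T' | subgraph G' G && isomorphic H G'].

Definition graph_free l (T T' : finType) (H : lgraph l T) (G : lgraph l T') :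
    bool :=
  copies H G == set0.

(* The l-graphs with vertex set [N], with [N] represented by 'I_N. *)
Definition lgraph_on (l N : nat) : Type :=
  {G : lgraph l 'I_N | vset G == [set: 'I_N]}.

HB.instance Definition _ l N := SubFinite.on (lgraph_on l N).

Coercion lgraph_of l N (G : lgraph_on l N) : lgraph l 'I_N := sval G.

Definition ex_number l (T : finType) (N : nat) (H : lgraph l T) : nat :=
  \max_(G : lgraph_on l N | graph_free H G) ne G.

From mathcomp Require Import all_order all_algebra.
From mathcomp Require Import all_classical all_reals all_analysis.
Import Order.TTheory GRing.Theory Num.Theory.
Import numFieldNormedType.Exports.
Local Open Scope classical_set_scope.
Local Open Scope ring_scope.

(* The default value 0 of the maximum is harmless: when 2 <= ne H the range is
   nonempty, and all the ratios are positive because a graph with two distinct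
   edges has more than l vertices. *)
Definition m_density (R : realType) l (T : finType) (H : lgraph l T) : R :=
  \big[Num.max/0]_(H' : lgraph l T | subgraph H' H && (1 < ne H')%N)
    (((ne H')%:R - 1) / ((nv H')%:R - l%:R)).

Definition turan_density (R : realType) l (T : finType) (H : lgraph l T) : R :=
  lim (((ex_number N H)%:R / 'C(N, l)%:R : R) @[N --> \oo]).

(* Main.v *)
Require Import Defs.
From HB Require Import structures.
From mathcomp Require Import all_boot all_order all_algebra.
From mathcomp Require Import all_classical all_reals all_analysis.
From mathcomp Require Import lra ring zify.
Import mathcomp.boot.fintype mathcomp.boot.finset.
Import Order.TTheory GRing.Theory Num.Theory.
Import numFieldNormedType.Exports.
Local Open Scope ring_scope.

Set Implicit Arguments.
Unset Strict Implicit.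
Unset Printing Implicit Defensive.

(** Take the [l]-subsets of the ground set as vertices and the edge sets of the
    copies of [H] as hyperedges. In this hypergraph, of uniformity [ne H], the
    independent sets are the [H]-free graphs, so the theorem is a container
    theorem for it.
    Weights are used in place of edge sets: an edge set is weighted by the number
    of embeddings of [H] that have it as image.

    A single container step, [container_step], goes by induction on the
    uniformity. Inside an independent set [I] take a maximal set [F] of
    about [p * n] vertices that supports a [bounded_link]: a hypergraph of
    uniformity one less, contained in the link of [F], with the expected weight
    and with controlled degrees. Either [F] has full size, and then [I] is
    independent in that link, which is again well spread; or [F] cannot be
    extended by any other vertex of [I], while [many_extensions] shows that a
    positive proportion of all vertices do extend it. In the second case those
    vertices can be left out of the container. The set [F] alone decides which
    case occurs and what the container is. Iterating the step in
    [hypergraph_containers] shrinks the container until it has few hyperedges,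
    that is, few copies of [H]; this takes boundedly many fingerprints, each of
    size at most [2 * (p * n)].

    With [n = N ^+ l] and [p = N `^ (- m^-1)] the product [p * n] is the power
    of [N] in the statement, and [deg_embedding_weight] verifies the degree
    hypotheses: by the definition of [m], any [j] edges of [H] cover at least
    [l + (j - 1) / m] vertices.

    A graph with few copies of [H] has few edges by [supersaturation], which also
    shows that the Turan ratios decrease and hence converge to the Turan density.
    The number of containers is at most the number of tuples of boundedly many
    small edge sets. *)

(** * Containers for weighted uniform hypergraphs *)

Section Weights.
Variables (R : realType) (X : finType).
Implicit Types (w g : {set X} -> R) (e s F I U : {set X}).

Definition deg w s : R := \sum_(e : {set X} | s \subset e) w e.

(** The co-degree hypothesis of the container method. With [alpha * (B * p * n)]
    the order of the total weight, [B * p] is the order of the average degree,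
    and enlarging a vertex set by one vertex costs its degree bound a factor
    [p]. *)
Definition spread (k : nat) U (n p B alpha : R) w :=
  [/\ forall e, 0 <= w e,
      forall e, 0 < w e -> e \subset U /\ #|e| = k,
      forall s, s != set0 -> deg w s <= B * p ^+ #|s| &
      alpha * (B * p * n) <= deg w set0].

Definition independent w I := forall e, e \subset I -> ~ 0 < w e.

Lemma deg_ge0 w s : (forall e, 0 <= w e) -> 0 <= deg w s.
Proof. by move=> w0; apply: sumr_ge0. Qed.

Lemma deg0E w : deg w set0 = \sum_e w e.
Proof. by apply: eq_bigl => e; rewrite sub0set. Qed.

Lemma sum_deg (J : finType) (h : J -> {set X}) (k c : nat) w :
  (forall e, 0 <= w e) -> (forall e, 0 < w e -> #|e| = k) ->
  (forall e : {set X}, #|e| = k -> #|[pred j | h j \subset e]| = c) ->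
  \sum_j deg w (h j) = c%:R * deg w set0.
Proof.
move=> w0 wk kc; rewrite deg0E /deg (exchange_big_dep predT) //= mulr_sumr.
apply: eq_bigr => e _; rewrite sumr_const -[_ *+ _]mulr_natl.
have [we|] := boolP (0 < w e); last first.
  by rewrite lt_def w0 andbT negbK => /eqP ->; rewrite !mulr0.
by congr (_%:R * _); rewrite -(kc e (wk e we)); apply: eq_card.
Qed.

Lemma sum_deg_subsets k w : (forall e, 0 <= w e) ->
  (forall e, 0 < w e -> #|e| = k) ->
  \sum_s deg w s = (2 ^ k)%:R * deg w set0.
Proof.
move=> w0 wk; apply: (sum_deg (h := id) w0 wk) => e <-.
by rewrite -card_powerset; apply: eq_card => s; rewrite powersetE.
Qed.

Lemma sum_deg_vertices k w : (forall e, 0 <= w e) ->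
  (forall e, 0 < w e -> #|e| = k) ->
  \sum_v deg w [set v] = k%:R * deg w set0.
Proof.
move=> w0 wk; apply: (sum_deg (h := set1) w0 wk) => e <-.
by apply: eq_card => v; rewrite inE sub1set.
Qed.

Definition saturated g (t : nat -> R) s := (s != set0) && (t #|s| < deg g s).

(** Deleting from [w] the edges through saturated sets makes it safe to add the
    link of any vertex to [g]: no saturated set gains degree. *)
Definition prune w g t e : R :=
  if [exists s : {set X}, (s \subset e) && saturated g t s] then 0 else w e.

Definition link w v e : R := if v \in e then 0 else w (v |: e).

Lemma prune_ge0 w g t : (forall e, 0 <= w e) -> forall e, 0 <= prune w g t e.
Proof. by move=> w0 e; rewrite /prune; case: ifP. Qed.

Lemma prune_le w g t : (forall e, 0 <= w e) -> forall e, prune w g t e <= w e.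
Proof. by move=> w0 e; rewrite /prune; case: ifP. Qed.

Lemma le_deg w w' s : (forall e, w e <= w' e) -> deg w s <= deg w' s.
Proof. by move=> h; apply: ler_sum. Qed.

Lemma deg_link w v s : v \notin s -> deg (link w v) s = deg w (v |: s).
Proof.
move=> vs; rewrite /deg (bigID (fun e : {set X} => v \in e)) /= big1 ?add0r; last first.
  by move=> e /andP[_ ve]; rewrite /link ve.
rewrite [RHS](reindex_onto (fun e => v |: e) (fun e => e :\ v)) /=; last first.
  by move=> e; rewrite subUset sub1set => /andP[ve _]; rewrite setD1K.
apply: eq_big => [e|e /andP[_ /negbTE ve]]; last by rewrite /link ve.
have [ve|ve] := boolP (v \in e).
  rewrite andbF; apply/esym/negbTE; rewrite negb_and; apply/orP; right.
  by apply/eqP => h; move: ve; rewrite -h !inE eqxx.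
rewrite setU1K // eqxx !andbT; apply/idP/idP => [/(setUS [set v])//|].
move=> h; apply/subsetP => x xs; have := subsetP h x.
rewrite !inE xs orbT => /(_ isT) /predU1P[xv|//].
by move: vs; rewrite -xv xs.
Qed.

Lemma deg_link_mem w v s : v \in s -> deg (link w v) s = 0.
Proof. by move=> vs; apply: big1 => e /subsetP/(_ v vs) ve; rewrite /link ve. Qed.

Lemma deg_prune_saturated w g t s : saturated g t s -> deg (prune w g t) s = 0.
Proof.
move=> sat; apply: big1 => e se; rewrite /prune.
by rewrite ifT //; apply/existsP; exists s; rewrite se.
Qed.

Lemma degD w w' s : deg (fun e => w e + w' e) s = deg w s + deg w' s.
Proof. exact: big_split. Qed.

(** A saturated set [s] has [deg w s <= c * t #|s| < c * deg g s], so the weight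
    lost is at most [c] times the sum of all degrees of [g], and every edge of
    [g] contributes to exactly [2 ^ k] of these. *)
Lemma prune_loss w g t c k : (forall e, 0 <= w e) -> (forall e, 0 <= g e) ->
  0 <= c -> (forall e, 0 < g e -> #|e| = k) ->
  (forall s, s != set0 -> deg w s <= c * t #|s|) ->
  deg w set0 - c * ((2 ^ k)%:R * deg g set0) <= deg (prune w g t) set0.
Proof.
move=> w0 g0 c0 gk wt; rewrite lerBlDr -lerBlDl -(sum_deg_subsets g0 gk).
have -> : deg w set0 - deg (prune w g t) set0 =
    \sum_(e : {set X} | [exists s : {set X}, (s \subset e) && saturated g t s]) w e.
  rewrite !deg0E -sumrB [RHS]big_mkcond; apply: eq_bigr => e _.
  by rewrite /prune; case: ifP => _; rewrite ?subr0 ?subrr.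
have : \sum_(s | saturated g t s) deg w s <= c * \sum_s deg g s.
  rewrite mulr_sumr (bigID (saturated g t) predT) /= -[leLHS]addr0.
  apply: lerD; last by apply: sumr_ge0 => s _; rewrite mulr_ge0 // deg_ge0.
  apply: ler_sum => s /andP[s0 /ltW ts].
  by apply: le_trans (wt s s0) _; rewrite ler_wpM2l.
apply: le_trans; rewrite /deg (exchange_big_dep predT) //= big_mkcond.
apply: ler_sum => e _; case: ifP => [/existsP[s /andP[se sat]]|_]; last exact: sumr_ge0.
by rewrite (bigD1 s) ?sat //= lerDl sumr_ge0.
Qed.

(** A [k]-uniform weight carried by the link of [F] in [w]. On average a vertex
    of [F] contributes at least the fraction [beta] of the largest possible
    degree [B * p], and the co-degree conditions are those of [w] with [B]
    replaced by [(M + 1) * (B * p)]. Only the support of [g] is tied to [w]: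
    this is what independence needs. *)
Definition bounded_link k (B p beta M : R) w F g :=
  [/\ forall e, 0 <= g e,
      forall e, 0 < g e ->
        #|e| = k /\ exists v, [/\ v \in F, v \notin e & 0 < w (v |: e)],
      #|F|%:R * (beta * (B * p)) <= deg g set0 <= #|F|%:R * (B * p) &
      forall s, s != set0 -> deg g s <= (M + 1) * (B * p) * p ^+ #|s|].

Lemma bounded_link0 k B p beta M w : 0 <= B -> 0 <= p -> 0 <= M ->
  bounded_link k B p beta M w set0 (fun=> 0).
Proof.
move=> B0 p0 M0; split=> [//|e|/=|s _]; first by rewrite ltxx.
  by rewrite cards0 !mul0r /deg big1 ?lexx.
by rewrite /deg big1 // !mulr_ge0 ?exprn_ge0 ?addr_ge0.
Qed.

(** The saturation threshold lies below the degree bound of [bounded_link] by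
    [B * p * p ^+ j], the most by which adding one link can raise a degree. *)
Definition cap (B p M : R) (j : nat) : R := M * (B * p) * p ^+ j.

(** Adding the link of [v] raises the degree of a set [s] by the pruned degree of
    [v |: s]. If [s] is saturated this is zero; otherwise [s] lies below the cap
    and gains at most [B * p ^+ #|s|.+1], which the bound leaves room for. *)
Lemma bounded_link_extend k U n B p beta M alpha w F g v :
  0 <= B -> 0 <= p -> 0 <= M ->
  spread k.+1 U n p B alpha w -> bounded_link k B p beta M w F g -> v \notin F ->
  beta * (B * p) <= deg (prune w g (cap B p M)) [set v] ->
  bounded_link k B p beta M w (v |: F)
    (fun e => g e + link (prune w g (cap B p M)) v e).
Proof.
set t := cap B p M => B0 p0 M0 [w0 wk wB _] [g0 gk gm gd] vF vbig.
have pw0 : forall e, 0 <= prune w g t e by exact: prune_ge0.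
have l0 e : 0 <= link (prune w g t) v e by rewrite /link; case: ifP.
have dle s : deg (prune w g t) s <= deg w s.
  by apply: le_deg => e; exact: prune_le.
split=> [e|e he|/=|s s0].
- exact: addr_ge0.
- have [ge|ge] := boolP (0 < g e).
    have [-> [x [xF xe wx]]] := gk e ge; split=> //.
    by exists x; rewrite !inE xF orbT.
  have {}ge : g e = 0 by apply/eqP; move: ge; rewrite lt_def g0 andbT negbK.
  move: he; rewrite ge add0r /link; case: ifP => [|/negbT ve he].
    by rewrite ltxx.
  have {}he : 0 < w (v |: e) by apply: lt_le_trans he _; exact: prune_le.
  have [_] := wk _ he; rewrite cardsU1 ve add1n => -[<-]; split=> //.
  by exists v; rewrite !inE eqxx.
- rewrite degD deg_link ?inE // setU0 cardsU1 vF natrD !mulrDl !mul1r.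
  case/andP: gm => gm1 gm2; rewrite addrC lerD //= addrC lerD //.
  apply: le_trans (dle _) _; apply: le_trans (wB [set v] _) _.
    by rewrite -cards_eq0 cards1.
  by rewrite cards1 expr1.
- rewrite degD; have [vs|vs] := boolP (v \in s).
    by rewrite deg_link_mem // addr0; apply: gd.
  rewrite deg_link //; have [sat|nsat] := boolP (saturated g t s).
    suff -> : deg (prune w g t) (v |: s) = 0 by rewrite addr0; apply: gd.
    apply/eqP; rewrite eq_le (deg_ge0 _ pw0) andbT -(deg_prune_saturated w sat).
    rewrite /deg big_mkcond [leRHS]big_mkcond; apply: ler_sum => e _.
    case: ifP => [|_]; last by case: ifP.
    by rewrite subUset => /andP[_ ->].
  move: nsat; rewrite /saturated s0 /= -leNgt /t /cap => h.
  rewrite !mulrDl mul1r lerD //; apply: le_trans (dle _) _.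
  apply: le_trans (wB _ _) _; first by apply/set0Pn; exists v; rewrite !inE eqxx.
  by rewrite cardsU1 vs exprS mulrA.
Qed.

(** With [M] this large, pruning loses at most half of the weight of [w], and
    then double counting the degrees of what remains leaves a positive
    proportion of vertices of degree at least [alpha / 4 * (B * p)]. *)
Lemma many_extensions k U (n B p alpha : R) w F g (M := 2 ^+ k.+2 / alpha) :
  0 < alpha -> 0 < B -> 0 < p -> 0 < n -> #|U|%:R <= n ->
  spread k.+1 U n p B alpha w -> bounded_link k B p (alpha / 4) M w F g ->
  #|F|%:R <= 2 * (p * n) ->
  alpha / 4 * n <=
    #|[set v in U |
        alpha / 4 * (B * p) <= deg (prune w g (cap B p M)) [set v]]|%:R.
Proof.
move=> a0 B0 p0 n0 Un [w0 wk wB wm] [g0 gk /andP[_ gm] gd] FL.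
set t := cap B p M; set Hi := [set v in U | _].
have M0 : 0 < M by rewrite divr_gt0 // exprn_gt0.
have pw0 : forall e, 0 <= prune w g t e by exact: prune_ge0.
have pwk e : 0 < prune w g t e -> #|e| = k.+1.
  by move=> h; have [] := wk e (lt_le_trans h (prune_le g t w0 e)).
have c0 : 0 <= 1 / (M * p) by rewrite divr_ge0 // mulr_ge0 // ltW.
have loss := prune_loss (t := t) w0 g0 c0 (fun e h => (gk e h).1).
have {}loss : alpha / 2 * (B * p * n) <= deg (prune w g t) set0.
  apply: le_trans (loss _) => [|s s0]; last first.
    rewrite /t /cap; apply: le_trans (wB s s0) _; rewrite le_eqVlt; apply/orP; left.
    by apply/eqP; field; rewrite ?gt_eqF.
  rewrite lerBrDr; apply: le_trans wm.
  rewrite -lerBrDl.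
  apply: (@le_trans _ _ (1 / (M * p) * ((2 ^ k)%:R * (2 * (p * n) * (B * p))))).
    apply: ler_wpM2l => //; apply: ler_wpM2l => //.
    by apply: le_trans gm _; apply: ler_wpM2r => //; rewrite mulr_ge0 // ltW.
  rewrite le_eqVlt; apply/orP; left; apply/eqP; rewrite /M natrX !exprS.
  have ? : (2 : R) ^+ k != 0 by rewrite expf_neq0 // pnatr_eq0.
  by field; rewrite ?gt_eqF // ; apply/and3P.
have : deg (prune w g t) set0 <= \sum_v deg (prune w g t) [set v].
  rewrite (sum_deg_vertices pw0 pwk) -[leLHS]mul1r ler_wpM2r ?deg_ge0 //.
  by rewrite ler1n.
have : \sum_v deg (prune w g t) [set v] <=
    #|Hi|%:R * (B * p) + #|U|%:R * (alpha / 4 * (B * p)).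
  rewrite (bigID (fun v => v \in Hi)) /=; apply: lerD.
    rewrite mulr_natl -sumr_const; apply: ler_sum => v _.
    apply: (@le_trans _ _ (deg w [set v])); first by apply: le_deg => e; apply: prune_le.
    by apply: le_trans (wB _ _) _; rewrite -?cards_eq0 cards1 ?expr1.
  rewrite (bigID (fun v => v \in U)) /= [X in _ + X]big1 ?addr0 => [|v /andP[_ vU]].
    apply: (@le_trans _ _ (\sum_(v in U) (alpha / 4 * (B * p)))); last first.
      by rewrite sumr_const mulr_natl.
    rewrite big_mkcond [leRHS]big_mkcond; apply: ler_sum => v _.
    have [vU|vU] := boolP (v \in U); last by rewrite andbF.
    rewrite andbT inE vU /= -ltNge; case: ifP => [/ltW//|_].
    by rewrite !mulr_ge0 ?invr_ge0 ?ltW.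
  apply: big1 => e; rewrite sub1set => ve; apply/eqP.
  rewrite eq_le pw0 andbT leNgt; apply/negP => h.
  have [/subsetP/(_ v ve)] := wk e (lt_le_trans h (prune_le g t w0 e)).
  by rewrite (negbTE vU).
have : #|U|%:R * (alpha / 4 * (B * p)) <= n * (alpha / 4 * (B * p)).
  by rewrite ler_wpM2r // !mulr_ge0 ?invr_ge0 ?ltW.
move=> h1 h2 h3; rewrite -(ler_pM2r (mulr_gt0 B0 p0)).
have := le_trans loss (le_trans h3 h2) => {loss h2 h3} h2.
rewrite -(lerD2r (n * (alpha / 4 * (B * p)))).
apply: le_trans (le_trans h2 _); last by rewrite lerD2l.
by rewrite le_eqVlt; apply/orP; left; apply/eqP; field.
Qed.
End Weights.

(** One application of the container method: the container misses a positive
    proportion of the vertices. By induction on the uniformity, with the base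
    case [k = 0] vacuous because the edge [set0] lies in every set. Let [F] be a
    maximal subset of [I] of at most [L] vertices (about [p * n]) that has a
    bounded link. If [F] has [L] vertices, its link is a spread hypergraph of
    uniformity one less in which [I] is still independent, and induction
    applies. If [F] is smaller, no vertex of [I] outside [F] extends it, so [F]
    together with the non-extending vertices is a container, and
    [many_extensions] says that it is small. Either way the container is
    computed from the fingerprint alone, because the link is a fixed choice for
    each [F]. *)
Theorem container_step (R : realType) (k : nat) (alpha : R) : 0 < alpha ->
  exists delta p0 : R, [/\ 0 < delta, 0 < p0 &
  forall (X : finType) (U : {set X}) (n p B : R) (w : {set X} -> R),
  #|U|%:R <= n -> 0 < p <= p0 -> 1 <= p * n -> 0 < B ->
  spread k U n p B alpha w ->
  exists cont : seq {set X} -> {set X}, forall I, independent w I ->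
  exists T : seq {set X},
    [/\ size T = k,
        forall F, F \in T -> F \subset I /\ #|F|%:R <= 2 * (p * n),
        I \subset cont T &
        delta * n <= #|U :\: cont T|%:R]].
Proof.
elim: k alpha => [|k IH] alpha a0.
  exists 1, 1; split=> // X U n p B w Un /andP[p0 _] pn B0 [w0 wk _ wm].
  exists (fun=> set0) => I indI; exfalso.
  have n0 : 0 < n by rewrite -(pmulr_rgt0 _ p0) (lt_le_trans ltr01).
  have : 0 < \sum_e w e.
    by rewrite -deg0E; apply: lt_le_trans wm; rewrite !mulr_gt0.
  rewrite lt_def psumr_neq0 // => /andP[/hasP[e _ /= we] _].
  have [_ /eqP] := wk e we; rewrite cards_eq0 => /eqP e0.
  by apply: (indI e) => //; rewrite e0 sub0set.
pose M := 2 ^+ k.+2 / alpha; have M0 : 0 < M by rewrite divr_gt0 // exprn_gt0.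
have [|delta [p0 [d0 p00 {}IH]]] := IH (alpha / 4 / (M + 1)).
  by rewrite !divr_gt0 // addr_gt0.
exists (Num.min delta (alpha / 8)), (Num.min p0 (alpha / 16)); split.
- by rewrite lt_min d0 divr_gt0.
- by rewrite lt_min p00 divr_gt0.
move=> X U n p B w Un /andP[pgt0]; rewrite le_min => /andP[pp0 pa] pn B0 spw.
have n0 : 0 < n by rewrite -(pmulr_rgt0 _ pgt0) (lt_le_trans ltr01).
(* The bounds p n <= L <= 2 p n use 1 <= p n. *)
pose L := (Num.truncn (p * n)).+1.
have L1 : p * n <= L%:R by rewrite ltW // truncnS_gt.
have L2 : L%:R <= 2 * (p * n).
  have /truncn_itv/andP[h _] : 0 <= p * n by rewrite mulr_ge0 // ltW.
  by rewrite /L -natr1 mulrDl !mul1r lerD.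
pose linkable F := exists g, bounded_link k B p (alpha / 4) M w F g.
have [G Gok] : {G & forall F, linkable F -> bounded_link k B p (alpha / 4) M w F (G F)}.
  apply: (boolp.choice (P := fun F g =>
    linkable F -> bounded_link k B p (alpha / 4) M w F g)) => F.
  by have [[g gg]|ng] := pselect (linkable F); [exists g|exists (fun=> 0) => /ng].
have [CF CFok] : {CF : {set X} -> seq {set X} -> {set X} & forall F,
    linkable F -> #|F| = L -> forall I, independent (G F) I -> exists T : seq {set X},
    [/\ size T = k,
        forall F, F \in T -> F \subset I /\ #|F|%:R <= 2 * (p * n),
        I \subset CF F T & delta * n <= #|U :\: CF F T|%:R]}.
  apply: (boolp.choice (P := fun F (c : seq {set X} -> {set X}) =>
    linkable F -> #|F| = L -> forall I,
    independent (G F) I -> exists T : seq {set X},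
    [/\ size T = k,
        forall F, F \in T -> F \subset I /\ #|F|%:R <= 2 * (p * n),
        I \subset c T & delta * n <= #|U :\: c T|%:R])) => F.
  have [linkF|ng] := pselect (linkable F); last by exists (fun=> set0) => /ng.
  have [FL|nL] := pselect (#|F| = L); last by exists (fun=> set0) => _ /nL.
  have [g0 gk /andP[gm _] gdeg] := Gok F linkF.
  have [|||||c cP] := IH X U n p ((M + 1) * (B * p)) (G F) => //.
  - by rewrite pgt0.
  - by rewrite !mulr_gt0 // addr_gt0.
  - split=> // [e ge|].
      have [ek [v [_ _ wv]]] := gk e ge; split=> //.
      have [_ /(_ _ wv)[+ _] _ _] := spw.
      by apply: subset_trans; apply: subsetUr.
    apply: le_trans gm; rewrite FL.
    apply: (@le_trans _ _ (p * n * (alpha / 4 * (B * p)))).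
      rewrite le_eqVlt; apply/orP; left; apply/eqP; field.
      by rewrite gt_eqF // addr_gt0.
    by apply: ler_wpM2r => //; rewrite !mulr_ge0 ?invr_ge0 // ltW.
  by exists c => _ _; apply: cP.
exists (fun T : seq {set X} => if T is F :: T' then
    if #|F| == L then CF F T' else F :|: [set v | ~~ `[< linkable (v |: F) >]]
  else set0) => I indI.
pose P (F : {set X}) := [&& F \subset I, (#|F| <= L)%N & `[< linkable F >]].
have P0 : P set0.
  rewrite /P sub0set cards0 /=; apply/asboolP; exists (fun=> 0).
  by apply: bounded_link0; apply: ltW.
case: (arg_maxnP (fun F : {set X} => #|F|) P0) => F /and3P[FI FL /asboolP gF] Fmax.
have [E|nE] := eqVneq #|F| L.
  have indG : independent (G F) I.
    move=> e eI ge; have [_ gk _ _] := Gok F gF.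
    have [_ [v [vF _ wv]]] := gk e ge; apply: (indI _ _ wv).
    by rewrite subUset sub1set (subsetP FI).
  have [T [sT TI IT dT]] := CFok F gF E I indG.
  exists (F :: T); rewrite /= sT E eqxx; split=> //.
    by move=> F'; rewrite inE => /predU1P[->|/TI//]; rewrite E.
  by apply: le_trans dT; rewrite ler_pM2r // ge_min lexx.
have {nE} FltL : (#|F| < L)%N by rewrite ltn_neqAle nE.
have FL2 : #|F|%:R <= 2 * (p * n) by apply: le_trans L2; rewrite ler_nat.
(* Padding keeps the number of fingerprints equal to k.+1 in both cases. *)
exists (F :: nseq k set0); rewrite /= size_nseq (ltn_eqF FltL); split=> //.
- move=> F'; rewrite inE => /predU1P[->//|]; rewrite mem_nseq => /andP[_ /eqP ->].
  by rewrite sub0set cards0 !mulr_ge0 // ltW.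
- apply/subsetP => v vI; rewrite !inE; have [//|vF /=] := boolP (v \in F).
  apply/negP => gv; have := Fmax (v |: F).
  rewrite /P subUset sub1set vI FI gv cardsU1 vF add1n FltL => /(_ isT).
  by rewrite /= ltnn.
(* The loss of at most 2 p n vertices to F itself is what p <= alpha / 16 pays
   for. *)
set Hi := [set v in U |
  alpha / 4 * (B * p) <= deg (prune w (G F) (cap B p M)) [set v]].
have HiL := many_extensions a0 B0 pgt0 n0 Un spw (Gok F gF) FL2.
have sub : Hi :\: F \subset U :\: (F :|: [set v | ~~ `[< linkable (v |: F) >]]).
  apply/subsetP => v; rewrite !inE => /and3P[vF vU vHi].
  rewrite vU (negbTE vF) /= andbT negbK; apply/asboolP; eexists.
  by apply: (bounded_link_extend _ _ _ spw (Gok F gF) vF vHi); apply: ltW.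
apply: (@le_trans _ _ #|Hi :\: F|%:R); last by rewrite ler_nat subset_leq_card.
have : #|Hi|%:R <= #|Hi :\: F|%:R + #|F|%:R :> R.
  rewrite -natrD ler_nat -[X in (X <= _)%N](cardsID F) addnC leq_add2l.
  by rewrite subset_leq_card // subsetIr.
have : Num.min delta (alpha / 8) * n <= alpha / 8 * n.
  by rewrite ler_pM2r // ge_min lexx orbT.
have : p * n <= alpha / 16 * n by rewrite ler_pM2r.
by move: HiL; rewrite -/Hi; lra.
Qed.

Definition weight_within (R : realType) (X : finType) (w : {set X} -> R)
    (C e : {set X}) : R :=
  if e \subset C then w e else 0.

(** Iterating [container_step] inside the current container, as long as that
    container carries more than [alpha * (B * p * n)] of weight. Each step
    removes at least [delta * n] vertices, so the number of steps is bounded;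
    the fingerprints of all steps are concatenated. *)
Theorem hypergraph_containers (R : realType) (r : nat) (alpha : R) : 0 < alpha ->
  exists (S : nat) (p0 : R), 0 < p0 /\
  forall (X : finType) (U : {set X}) (n p B : R) (w : {set X} -> R),
  #|U|%:R <= n -> 0 < p <= p0 -> 1 <= p * n -> 0 < B ->
  (forall e, 0 <= w e) ->
  (forall e, 0 < w e -> #|e| = r) ->
  (forall s, s != set0 -> deg w s <= B * p ^+ #|s|) ->
  exists cont : seq {set X} -> {set X},
  forall I : {set X}, I \subset U -> independent w I ->
  exists T : seq {set X},
    [/\ size T = S,
        forall F : {set X}, F \in T -> F \subset I /\ #|F|%:R <= 2 * (p * n),
        I \subset cont T, cont T \subset U &
        deg (weight_within w (cont T)) set0 <= alpha * (B * p * n)].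
Proof.
move=> a0; have [delta [p0 [d0 p00 step]]] := container_step r a0.
pose J := (Num.truncn delta^-1).+1.
exists (J * r)%N, p0; split=> // X U n p B w Un pp0 pn B0 w0 wr wB.
have n0 : 0 < n.
  by case/andP: pp0 => pgt0 _; rewrite -(pmulr_rgt0 _ pgt0) (lt_le_trans ltr01).
have ind0 C e : 0 <= weight_within w C e by rewrite /weight_within; case: ifP.
have indle C e : weight_within w C e <= w e by rewrite /weight_within; case: ifP.
suff iter j : forall C : {set X}, exists c : seq {set X} -> {set X},
    C \subset U -> #|C|%:R <= j%:R * (delta * n) ->
    forall I : {set X}, I \subset C -> independent w I -> exists T : seq {set X},
    [/\ size T = (j * r)%N,
        forall F : {set X}, F \in T -> F \subset I /\ #|F|%:R <= 2 * (p * n),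
        I \subset c T, c T \subset U &
        deg (weight_within w (c T)) set0 <= alpha * (B * p * n)].
  have [c cP] := iter J U; exists c; apply: cP => //.
  apply: le_trans Un _; rewrite mulrA -[leLHS]mul1r ler_pM2r //.
  by rewrite -ler_pdivrMr // div1r ltW // truncnS_gt.
have stop (m : nat) (C : {set X}) : C \subset U ->
    deg (weight_within w C) set0 <= alpha * (B * p * n) ->
    forall I : {set X}, I \subset C -> exists T : seq {set X},
    [/\ size T = m,
        forall F : {set X}, F \in T -> F \subset I /\ #|F|%:R <= 2 * (p * n),
        I \subset C, C \subset U &
        deg (weight_within w C) set0 <= alpha * (B * p * n)].
  move=> CU small I IC; exists (nseq m set0); rewrite size_nseq; split=> // F.
  rewrite mem_nseq => /andP[_ /eqP ->]; rewrite sub0set cards0; split=> //.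
  by rewrite !mulr_ge0 //; [case/andP: pp0 => /ltW|apply: ltW].
have split (C : {set X}) : C \subset U ->
    alpha * (B * p * n) < deg (weight_within w C) set0 ->
    exists c : seq {set X} -> {set X}, forall I, independent w I ->
    exists T : seq {set X},
    [/\ size T = r,
        forall F : {set X}, F \in T -> F \subset I /\ #|F|%:R <= 2 * (p * n),
        I \subset c T & delta * n <= #|C :\: c T|%:R].
  move=> CU big.
  have Cn : #|C|%:R <= n by apply: le_trans Un; rewrite ler_nat subset_leq_card.
  have spC : spread r C n p B alpha (weight_within w C).
    split=> // [e|s s0|]; last by rewrite ltW.
      by rewrite /weight_within; case: ifP => [eC /wr ->//|_]; rewrite ltxx.
    by apply: le_trans (wB s s0); apply: le_deg.
  have [c cP] := step X C n p B _ Cn pp0 pn B0 spC.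
  exists c => I indI; apply: cP => e eI we; apply: (indI e eI).
  exact: lt_le_trans we _.
elim: j => [|j IH] C;
  (have [CU|nCU] := boolP (C \subset U); last by exists (fun=> C));
  (have [small|big] := leP (deg (weight_within w C) set0) (alpha * (B * p * n));
    first by exists (fun=> C) => _ _ I IC _; apply: stop);
  have [c cP] := split C CU big.
  (* A further step is impossible in an empty container. *)
  exists c => _; rewrite mul0r => C0 I IC /cP[T [_ _ _ h]].
  have : #|C :\: c T|%:R <= #|C|%:R :> R.
    by rewrite ler_nat subset_leq_card // subsetDl.
  by move=> /(le_trans h)/le_trans/(_ C0); rewrite leNgt mulr_gt0.
have [c' c'P] := boolp.choice IH.
exists (fun T : seq {set X} => c' (C :&: c (take r T)) (drop r T)) => _ Cj I IC indI.
have [T [sT TI IT dT]] := cP I indI.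
have [||||T' [sT' TI' IT' TU' dT']] := c'P (C :&: c T) _ _ I => //.
- by apply: subset_trans CU; apply: subsetIl.
- move: Cj; rewrite -natr1 mulrDl mul1r -(cardsID (c T) C) natrD => h.
  by rewrite -(lerD2r (delta * n)); apply: le_trans h; rewrite lerD2l.
- by rewrite subsetI IC.
exists (T ++ T'); rewrite size_cat sT sT' mulSn -sT take_size_cat // drop_size_cat //.
by split=> // F; rewrite mem_cat => /orP[/TI|/TI'].
Qed.

(** * Embeddings and codegrees *)

Section Embeddings.
Variables (l : nat) (V : finType) (H : lgraph l V).
Local Notation W := {x : V | x \in vset H}.

Lemma edge_sub (T : finType) (G : lgraph l T) (e : {set T}) :
  e \in eset G -> e \subset vset G.
Proof. by move=> eG; have /forallP/(_ e)/implyP/(_ eG)/andP[] := lgraph_valP G. Qed.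

Lemma card_edge (T : finType) (G : lgraph l T) (e : {set T}) : e \in eset G -> #|e| = l.
Proof.
by move=> eG; have /forallP/(_ e)/implyP/(_ eG)/andP[_ /eqP] := lgraph_valP G.
Qed.

(** Copies of [H] are counted through injections of its vertex set, isolated
    vertices included: each copy is counted at least once, and codegrees become
    counts of restricted functions. *)
Definition edge_image (T : finType) (f : {ffun W -> T}) (e : {set V}) : {set T} :=
  [set f x | x : W & val x \in e].

Definition image_edges (T : finType) (f : {ffun W -> T}) : {set {set T}} :=
  [set edge_image f e | e in eset H].

Definition embeddings (T : finType) (C : {set {set T}}) : {set {ffun W -> T}} :=
  [set f : {ffun W -> T} | injectiveb f & image_edges f \subset C].

Lemma card_vertex_type : #|{: W}| = nv H.
Proof. by rewrite card_sig; apply: eq_card. Qed.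

Lemma card_edge_image (T : finType) (f : {ffun W -> T}) (e : {set V}) :
  injective f -> e \subset vset H -> #|edge_image f e| = #|e|.
Proof.
move=> fi eV; rewrite card_imset // -(card_imset _ val_inj).
apply: eq_card => x; apply/imsetP/idP => [[y]|xe]; first by rewrite inE => ye ->.
by exists (Sub x (subsetP eV x xe)) => //; rewrite inE.
Qed.

Lemma edge_image_inj (T : finType) (f : {ffun W -> T}) : injective f ->
  {in eset H &, injective (edge_image f)}.
Proof.
move=> fi e e' eH e'H /(imset_inj fi) E; apply/setP => x.
have [xV|xV] := boolP (x \in vset H).
  by move/setP/(_ (Sub x xV)): E; rewrite !inE.
by rewrite !(contraNF (subsetP (edge_sub _) x) xV).
Qed.

Lemma card_image_edges (T : finType) (f : {ffun W -> T}) :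
  injective f -> #|image_edges f| = ne H.
Proof. by move=> fi; rewrite card_in_imset //; apply: edge_image_inj. Qed.

Lemma image_edges_card (T : finType) (f : {ffun W -> T}) (e : {set T}) :
  injective f -> e \in image_edges f -> #|e| = l.
Proof.
move=> fi /imsetP[e' e'H ->].
by rewrite card_edge_image ?(card_edge e'H) // (edge_sub e'H).
Qed.

Lemma copies_le_embeddings (T : finType) (G : lgraph l T) :
  (#|copies H G| <= #|embeddings (eset G)|)%N.
Proof.
rewrite -(card_imset _ val_inj).
apply: leq_trans (leq_imset_card
  (fun f : {ffun W -> T} => ([set f x | x : W], image_edges f)) _).
apply: subset_leq_card; apply/subsetP => _ /imsetP[G' + ->].
rewrite inE => /andP[/andP[_ G'G] /existsP[f /and3P[fi /eqP fV /eqP fE]]].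
have E : image_edges f = eset G' by rewrite -fE.
apply/imsetP; exists f; first by rewrite inE fi E.
by rewrite fV E; apply: surjective_pairing.
Qed.

Lemma embeddings_graph_free (T : finType) (G : lgraph l T) :
  vset G = [set: T] -> graph_free H G -> embeddings (eset G) = set0.
Proof.
move=> GT /eqP free; apply/eqP; rewrite -subset0; apply/subsetP => f.
rewrite inE => /andP[/injectiveP fi fE].
have ok : [forall e in ([set f x | x : W], image_edges f).2,
    (e \subset ([set f x | x : W], image_edges f).1) && (#|e| == l)].
  apply/forallP => e; apply/implyP => /= eE; rewrite (image_edges_card fi eE) eqxx andbT.
  case/imsetP: eE => e' _ ->; apply/subsetP => y /imsetP[x _ ->].
  exact: imset_f.
suff : LGraph ok \in copies H G by rewrite free inE.
rewrite inE /subgraph GT subsetT fE /=; apply/existsP; exists f.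
by apply/and3P; split=> //; apply/injectiveP.
Qed.

Lemma graph_free_embeddings (T : finType) (G : lgraph l T) :
  embeddings (eset G) = set0 -> graph_free H G.
Proof.
move=> E; rewrite /graph_free -cards_eq0 -leqn0.
by apply: leq_trans (copies_le_embeddings G) _; rewrite E cards0.
Qed.

Lemma card_restricted_ffun (T : finType) (A : {set W}) (Y : {set T}) :
  #|[set f : {ffun W -> T} | [forall x in A, f x \in Y]]| =
  (#|Y| ^ #|A| * #|T| ^ (nv H - #|A|))%N.
Proof.
transitivity #|family (fun x : W => if x \in A then mem Y else mem T)|.
  apply: eq_card => f; rewrite inE; apply/forallP/familyP => h x;
  have := h x; case: ifP => //= _ ; exact: implyP.
rewrite card_family -[in RHS]card_vertex_type foldrE big_map big_enum /=.
rewrite (bigID (fun x => x \in A)) /=; congr (_ * _)%N.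
  by rewrite (eq_bigr (fun=> #|Y|)) ?prod_nat_const // => x ->.
rewrite (eq_bigr (fun=> #|T|)) => [|x /negbTE -> //]; rewrite prod_nat_const.
by congr (_ ^ _)%N; rewrite -(cardC A) addKn; apply: eq_card.
Qed.


(** The edges of [H] mapped onto [s] form a set [S] of [#|s|] edges, one of at
    most [2 ^ ne H]. They send the vertices covered by [S] onto those covered by
    [s], of which there are equally many; the other vertices are free. *)
Lemma codegree_bound (T : finType) (s : {set {set T}}) (d : nat) :
  (forall S : {set {set V}}, S \subset eset H -> #|S| = #|s| ->
     (#|T| ^ (nv H - #|cover S|) <= d)%N) ->
  (#|[set f : {ffun W -> T} | injectiveb f & s \subset image_edges f]|
    <= 2 ^ ne H * (nv H ^ nv H * d))%N.
Proof.
move=> dP.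
set A := [set f : {ffun W -> T} | _ & _].
pose fib (S : {set {set V}}) := [set f in A | [set edge_image f e | e in S] == s].
have cov : A \subset \bigcup_(S in powerset (eset H) | #|S| == #|s|) fib S.
  apply/subsetP => f fA; move: (fA); rewrite inE => /andP[/injectiveP fi sf].
  pose S := [set e in eset H | edge_image f e \in s].
  have SH : S \subset eset H by apply/subsetP => e; rewrite inE => /andP[].
  have ES : [set edge_image f e | e in S] = s.
    apply/setP => y; apply/imsetP/idP => [[e]|ys]; first by rewrite inE => /andP[_ h] ->.
    have /imsetP[e eH ye] := subsetP sf y ys; exists e => //.
    by rewrite inE eH -ye.
  apply/bigcupP; exists S; last by rewrite inE fA ES /=.
  rewrite powersetE SH /= -ES card_in_imset // => e e' eS e'S.
  by apply: (edge_image_inj fi); apply: (subsetP SH).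
apply: leq_trans (subset_leq_card cov) _.
apply: leq_trans (_ : (\sum_(S in powerset (eset H) | #|S| == #|s|) #|fib S| <= _)%N).
  elim/big_rec2: _ => [|S m B _ h]; first by rewrite cards0.
  by apply: leq_trans (leq_add (leqnn _) h); rewrite cardsU leq_subr.
rewrite -card_powerset -sum_nat_const big_mkcondr.
apply: leq_sum => S; rewrite powersetE => SH; case: ifP => // /eqP Ss.
pose B := [set x : W | val x \in cover S].
have BS : #|B| = #|cover S|.
  rewrite -(card_imset _ val_inj); apply: eq_card => x.
  apply/imsetP/idP => [[y]|xe]; first by rewrite inE => ye ->.
  have xV : x \in vset H.
    by case/bigcupP: xe => e eS; apply: (subsetP (edge_sub _)); apply: (subsetP SH).
  by exists (Sub x xV) => //; rewrite inE.
have [->|[f0 f0P]] := set_0Vmem (fib S); first by rewrite cards0.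
have imB f : f \in fib S -> [set f x | x in B] = cover s.
  rewrite inE => /andP[_ /eqP <-]; apply/setP => y; apply/imsetP/bigcupP.
    case=> x; rewrite inE => /bigcupP[e eS xe] ->.
    exists (edge_image f e); first exact: imset_f.
    by apply: imset_f; rewrite inE.
  case=> _ /imsetP[e eS ->] /imsetP[x]; rewrite inE => xe ->.
  by exists x => //; rewrite inE; apply/bigcupP; exists e.
have sB : #|cover s| = #|B|.
  move: (f0P); rewrite !inE => /andP[/andP[/injectiveP fi _] _].
  by rewrite -(imB f0 f0P) card_imset.
have Bv : (#|B| <= nv H)%N by rewrite -card_vertex_type max_card.
apply: leq_trans (_ : #|[set f : {ffun W -> T} |
    [forall x in B, f x \in cover s]]| <= _)%N.
  apply: subset_leq_card; apply/subsetP => f fS; rewrite inE; apply/forallP => x.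
  by apply/implyP => xB; rewrite -(imB f fS) imset_f.
rewrite card_restricted_ffun sB; apply: leq_mul.
  have [->|B0] := posnP #|B|; first by rewrite expn0 expn_gt0; case: (nv H).
  by apply: leq_trans (leq_pexp2l B0 Bv) _; rewrite leq_exp2r // (leq_trans B0).
by rewrite BS; apply: dP.
Qed.
End Embeddings.

(** * Supersaturation and the Turan density *)

(** In the degenerate cases [n < #|B|] and [#|T| < n] both sides vanish. *)
Lemma card_supersets (T : finType) (B : {set T}) n :
  (#|[set A : {set T} | (B \subset A) && (#|A| == n)]| * 'C(#|T|, #|B|) =
   'C(#|T|, n) * 'C(n, #|B|))%N.
Proof.
set N := #|T|; set b := #|B|.
have bN : (b <= N)%N by exact: max_card.
have [ltnb|bn] := ltnP n b.
  rewrite (bin_small ltnb) muln0; set S := finset _.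
  suff -> : S = set0 by rewrite cards0.
  apply/setP => A; rewrite !inE; apply/negP => /andP[/subset_leq_card h /eqP E].
  by move: h; rewrite E leqNgt ltnb.
have [ltNn|nN] := ltnP N n.
  rewrite (bin_small ltNn) mul0n; set S := finset _.
  suff -> : S = set0 by rewrite cards0.
  apply/setP => A; rewrite !inE; apply/negP => /andP[_ /eqP E].
  by have := max_card (mem A); rewrite E leqNgt ltNn.
have -> : #|[set A : {set T} | (B \subset A) && (#|A| == n)]| = 'C(N - b, n - b).
  have -> : [set A : {set T} | (B \subset A) && (#|A| == n)] =
      [set B :|: D | D in [set D : {set T} | D \subset ~: B & #|D| == n - b]%N].
    apply/setP => A; rewrite inE; apply/andP/imsetP => [[BA /eqP An]|[D]].
      exists (A :\: B); last by rewrite -{1}(setID A B) (setIidPr BA).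
      rewrite inE setDE subsetIr /=.
      by rewrite -setDE cardsD (setIidPr BA) An.
    rewrite inE subsetC => /andP[DB /eqP Dn] ->; rewrite subsetUl; split=> //.
    have BD : B :&: D = set0.
      apply/eqP; rewrite setI_eq0 disjoint_subset; apply: subset_trans DB _.
      by apply/subsetP => x; rewrite !inE.
    by rewrite cardsU BD cards0 subn0 Dn subnKC.
  have Bc : #|~: B| = (N - b)%N by rewrite [LHS]cardsCs setCK.
  rewrite card_in_imset ?cards_draws ?Bc // => D D'.
  rewrite !inE => /andP[DB _] /andP[D'B _] E.
  have K (S : {set T}) : S \subset ~: B -> (B :|: S) :\: B = S.
    by move=> SB; rewrite setDUl setDv set0U; apply/setDidPl; rewrite disjoints_subset.
  by rewrite -(K D) // E K.
have h4 : ((N - b) - (n - b) = N - n)%N by rewrite subnBA // subnK.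
have h1 := bin_fact nN; have h2 := bin_fact bn; have h3 := bin_fact bN.
have := @bin_fact (N - b) (n - b) (leq_sub2r b nN); rewrite h4 => h5.
have p1 : (0 < b`! * ((n - b)`! * (N - n)`!))%N by rewrite !muln_gt0 !fact_gt0.
apply/eqP; rewrite -(eqn_pmul2r p1); apply/eqP.
transitivity (N`!)%N; first by rewrite -h3 -h5; ring.
by rewrite -h1 -h2; ring.
Qed.

(** Averaging over the [n]-subsets of [T]: a fixed [b]-subset lies in the
    fraction ['C(n, b) / 'C(#|T|, b)] of them. *)
Lemma sum_card_supersets (R : realType) (T J : finType) (F : {set J})
    (h : J -> {set T}) (n b : nat) : (forall j, j \in F -> #|h j| = b) ->
  (\sum_(A : {set T} | #|A| == n) #|[set j in F | h j \subset A]|)%:R =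
    #|F|%:R * ('C(#|T|, n)%:R * ('C(n, b)%:R / 'C(#|T|, b)%:R)) :> R.
Proof.
move=> hb.
have -> : (\sum_(A : {set T} | #|A| == n) #|[set j in F | h j \subset A]| =
    \sum_(j in F) #|[set A : {set T} | (h j \subset A) && (#|A| == n)]|)%N.
  transitivity (\sum_(A : {set T} | #|A| == n) \sum_(j in F | h j \subset A) 1)%N.
    apply: eq_bigr => A _; rewrite -sum1_card; apply: eq_bigl => j.
    by rewrite inE.
  rewrite (exchange_big_dep (fun j => j \in F)) /= => [|A j _ /andP[]//].
  apply: eq_bigr => j jF; rewrite -sum1_card; apply: eq_bigl => A.
  by rewrite inE jF /= andbC.
rewrite natr_sum -[X in X * _]sumr_const.
rewrite mulr_suml; apply: eq_bigr => j jF; rewrite mul1r mulrA.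
have C0 : 'C(#|T|, b)%:R != 0 :> R.
  by rewrite pnatr_eq0 -lt0n bin_gt0 -(hb j jF) max_card.
by apply: (canRL (mulfK C0)); rewrite -!natrM -(hb j jF) card_supersets.
Qed.

Section Turan.
Variables (R : realType) (l : nat) (V : finType) (H : lgraph l V).
Local Notation W := {x : V | x \in vset H}.

(** Pulling the edges back along an enumeration of [A] gives an [H]-free graph
    on [#|A|] vertices. *)
Lemma turan_bound (T : finType) (A : {set T}) (E : {set {set T}}) :
  (forall e, e \in E -> #|e| = l /\ e \subset A) ->
  (forall f : {ffun W -> T}, f \in embeddings H E ->
     ~~ ([set f x | x : W] \subset A)) ->
  (#|E| <= ex_number #|A| H)%N.
Proof.
move=> EP free.
pose phi : 'I_#|A| -> T := @enum_val T (mem A).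
have phi_inj : injective phi by exact: enum_val_inj.
pose E' := [set s : {set 'I_#|A|} | phi @: s \in E].
have ok : [forall e in ([set: 'I_#|A|], E').2,
    (e \subset ([set: 'I_#|A|], E').1) && (#|e| == l)].
  apply/forallP => s; apply/implyP => /=; rewrite inE subsetT /= => /EP[<- _].
  by rewrite card_imset.
have okV : vset (LGraph ok) == [set: 'I_#|A|] by [].
pose G : lgraph_on l #|A| := exist _ (LGraph ok) okV.
have EE' : E \subset [set phi @: s | s : {set 'I_#|A|} in E'].
  apply/subsetP => e eE; have [_ eA] := EP e eE.
  have Ee : phi @: (phi @^-1: e) = e.
    apply/setP => x; apply/imsetP/idP => [[i]|xe]; first by rewrite inE => ie ->.
    have xA := subsetP eA x xe.
    by exists (enum_rank_in xA x); rewrite ?inE /phi enum_rankK_in.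
  by apply/imsetP; exists (phi @^-1: e); rewrite // inE Ee.
apply: leq_trans (subset_leq_card EE') _; rewrite card_imset; last exact: imset_inj.
have Gfree : graph_free H G.
  apply: graph_free_embeddings; apply/eqP; rewrite -subset0; apply/subsetP => f.
  rewrite inE => /andP[/injectiveP fi fE].
  pose g : {ffun W -> T} := [ffun x => phi (f x)].
  suff : g \in embeddings H E.
    move/free => /negP; case; apply/subsetP => _ /imsetP[x _ ->].
    by rewrite ffunE /phi; apply: enum_valP.
  rewrite inE; apply/andP; split.
    by apply/injectiveP => x y; rewrite !ffunE => /phi_inj/fi.
  apply/subsetP => y /imsetP[e eH ->] {y}.
  have := subsetP fE _ (imset_f (edge_image f) eH); rewrite inE.
  suff -> : edge_image g e = phi @: edge_image f e by [].
  by rewrite /edge_image -imset_comp; apply: eq_imset => x; rewrite ffunE.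
exact: (leq_bigmax_cond (F := fun G : lgraph_on l #|A| => ne G) G Gfree).
Qed.

(** Erdos-Simonovits supersaturation: an [n]-subset carries at most
    [ex_number n H] edges unless it contains an embedding of [H]; average this
    over all [n]-subsets. With no embedding at all it gives the monotonicity of
    the Turan ratios. *)
Lemma supersaturation (T : finType) (E : {set {set T}}) (n : nat) :
  (l <= n <= #|T|)%N -> (forall e, e \in E -> #|e| = l) ->
  #|E|%:R / 'C(#|T|, l)%:R <=
    (ex_number n H)%:R / 'C(n, l)%:R
    + #|embeddings H E|%:R * ('C(n, nv H)%:R / 'C(#|T|, nv H)%:R) :> R.
Proof.
case/andP=> ln nN El.
pose EA (A : {set T}) := [set e in E | e \subset A].
pose FA (A : {set T}) :=
  [set f in embeddings H E | [set f x | x : W] \subset A].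
have each (A : {set T}) : #|A| == n ->
    (#|EA A| <= ex_number n H + 'C(n, l) * #|FA A|)%N.
  move=> /eqP An; have [F0|F0] := posnP #|FA A|.
    rewrite F0 muln0 addn0 -An; apply: turan_bound => [e|f fE].
      by rewrite inE => /andP[/El -> ->].
    have fE' : f \in embeddings H E.
      move: fE; rewrite !inE => /andP[-> /=]; move/subset_trans; apply.
      by apply/subsetP => e; rewrite inE => /andP[].
    apply/negP => fA; move/eqP: F0; rewrite cards_eq0 => /eqP/setP/(_ f).
    by rewrite inE fE' fA inE.
  apply: leq_trans (leq_addl _ _); apply: leq_trans (leq_pmulr _ F0).
  rewrite -An -cards_draws; apply: subset_leq_card; apply/subsetP => e.
  by rewrite !inE => /andP[/El -> ->]; rewrite eqxx.
have sumE := sum_card_supersets R n El.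
have card_range (f : {ffun W -> T}) :
    f \in embeddings H E -> #|[set f x | x : W]| = nv H.
  rewrite inE => /andP[/injectiveP fi _].
  by rewrite card_imset // -card_vertex_type; apply: eq_card.
have sumF := sum_card_supersets R n card_range.
have lN := leq_trans ln nN.
have CNl : 0 < 'C(#|T|, l)%:R :> R by rewrite ltr0n bin_gt0.
have Cnl : 0 < 'C(n, l)%:R :> R by rewrite ltr0n bin_gt0.
have CNn : 0 < 'C(#|T|, n)%:R :> R by rewrite ltr0n bin_gt0.
have : (\sum_(A : {set T} | #|A| == n) #|EA A| <=
    'C(#|T|, n) * ex_number n H
    + 'C(n, l) * \sum_(A : {set T} | #|A| == n) #|FA A|)%N.
  rewrite -[X in (X * _ + _)%N](card_draws T n) -sum_nat_cond_const.
  by rewrite [X in (_ + X)%N]big_distrr -big_split /=; apply: leq_sum.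
rewrite -(ler_nat R) natrD !natrM sumE sumF.
move: (_ / 'C(#|T|, nv H)%:R) => z key.
rewrite -(ler_pM2r Cnl) -(ler_pM2r CNn).
apply: le_trans (le_trans key _); rewrite le_eqVlt; apply/orP; left; apply/eqP.
  by field; rewrite gt_eqF.
by field; rewrite gt_eqF.
Qed.
End Turan.

Section TuranLimit.
Variables (R : realType) (l : nat) (V : finType) (H : lgraph l V).

Lemma ex_number_antitone (n N : nat) : (l <= n <= N)%N ->
  (ex_number N H)%:R / 'C(N, l)%:R <= (ex_number n H)%:R / 'C(n, l)%:R :> R.
Proof.
move=> /andP[ln nN].
have C0 : 0 < 'C(N, l)%:R :> R by rewrite ltr0n bin_gt0 (leq_trans ln).
rewrite ler_pdivrMr //; set y := _ / _ * _.
have y0 : 0 <= y by rewrite mulr_ge0 ?divr_ge0.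
rewrite /ex_number; elim/big_ind: _ => // [a b ay bY|G Gfree].
  by case: leqP.
rewrite -ler_pdivrMr //.
have GT : vset (lgraph_of G) = [set: 'I_N] by apply/eqP; apply: (svalP G).
have := @supersaturation R l V H 'I_N (eset (lgraph_of G)) n.
rewrite ln card_ord nN (embeddings_graph_free GT Gfree) cards0 mul0r addr0.
by apply=> // e; apply: card_edge.
Qed.

Lemma turan_density_approx (eps : R) : 0 < eps ->
  exists2 n : nat, (l <= n)%N &
    (ex_number n H)%:R / 'C(n, l)%:R <= turan_density R H + eps.
Proof.
move=> e0; set u := fun n => (ex_number n H)%:R / 'C(n, l)%:R : R.
have u0 n : 0 <= u n by rewrite divr_ge0.
have cu : cvgn u.
  apply: (@near_nonincreasing_is_cvgn _ _ 0).
    exists l => // n /= ln m nm; apply: ex_number_antitone.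
    by rewrite ln nm.
  by exists 0.
have /cvgrPdist_le /(_ eps e0)[n0 _ n0P] : (u @ \oo --> turan_density R H)%classic by [].
exists (maxn l n0); first exact: leq_maxl.
have := n0P (maxn l n0) (leq_maxr _ _); rewrite -/(u _) distrC ler_norml => /andP[_].
by rewrite lerBlDr addrC.
Qed.

Lemma expn_le_bin (N v : nat) : (2 * v <= N)%N ->
  (N ^ v <= 2 ^ v * v`! * 'C(N, v))%N.
Proof.
move=> vN; rewrite -mulnA [(v`! * _)%N]mulnC bin_ffact ffact_prod.
rewrite -{2}(card_ord v) -prod_nat_const -big_split /=.
rewrite -{1}(card_ord v) -prod_nat_const; apply: leq_prod => i _.
have := ltn_ord i; lia.
Qed.

(** Supersaturation at a fixed [n] whose Turan ratio is within [eps / 2] of the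
    density; [expn_le_bin] turns the bound on embeddings, of order
    [#|T| ^ nv H], into one relative to ['C(#|T|, nv H)]. *)
Lemma few_embeddings_sparse (eps : R) : 0 < eps ->
  exists2 gamma : R, 0 < gamma & exists N0 : nat,
  forall (T : finType) (E : {set {set T}}), (N0 <= #|T|)%N ->
    (forall e, e \in E -> #|e| = l) ->
    #|embeddings H E|%:R <= gamma * #|T|%:R ^+ nv H ->
    #|E|%:R <= (turan_density R H + eps) * 'C(#|T|, l)%:R.
Proof.
move=> e0; have e20 : 0 < eps / 2 by rewrite divr_gt0.
have [n ln nP] := turan_density_approx e20.
set v := nv H; pose K : R := (2 ^ v * v`!)%:R; pose D : R := ('C(n, v)).+1%:R.
have K0 : 0 < K by rewrite ltr0n muln_gt0 expn_gt0 fact_gt0.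
have D0 : 0 < D by rewrite ltr0n.
exists (eps / 2 / D / K); first by rewrite !divr_gt0.
exists (maxn n (2 * v)) => T E; rewrite geq_max => /andP[nT vT] El few.
have C0 : 0 < 'C(#|T|, l)%:R :> R by rewrite ltr0n bin_gt0 (leq_trans ln).
have Cv0 : 0 < 'C(#|T|, v)%:R :> R.
  by rewrite ltr0n bin_gt0; apply: leq_trans vT; rewrite leq_pmull.
rewrite -ler_pdivrMr //.
have := @supersaturation R l V H T E n; rewrite ln nT => /(_ isT El)/le_trans; apply.
rewrite [eps]splitr addrA; apply: lerD => //.
rewrite mulrA ler_pdivrMr //.
apply: (@le_trans _ _ (eps / 2 / D / K * #|T|%:R ^+ v * D)).
  apply: ler_pM => //; first by rewrite ler_nat leqnSn.
have -> : eps / 2 / D / K * #|T|%:R ^+ v * D = eps / 2 * (#|T|%:R ^+ v / K).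
  have cancel a b c x : b != 0 -> c != 0 -> a / b / c * x * b = a * (x / c) :> R.
    by move=> b0 c0; field; apply/andP.
  by rewrite cancel // gt_eqF.
apply: ler_wpM2l; first exact: ltW.
rewrite ler_pdivrMr // mulrC -natrX -natrM ler_nat.
exact: expn_le_bin.
Qed.
End TuranLimit.

(** * The hypergraph of copies *)

Section Density.
Variables (R : realType) (l : nat) (V : finType) (H : lgraph l V).

Lemma cover_gt (S : {set {set V}}) : S \subset eset H -> (1 < #|S|)%N ->
  (l < #|cover S|)%N.
Proof.
move=> SH /card_gt1P[e [e' [eS e'S ee']]].
have ce (x : {set V}) : x \in S -> #|x| = l.
  by move=> xS; apply: (card_edge (G := H)); apply: (subsetP SH).
have sub (x : {set V}) : x \in S -> x \subset cover S.
  by move=> xS; apply: bigcup_sup.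
rewrite -(ce e eS) ltnNge; apply/negP => h.
have /eqP E1 : e == cover S by rewrite eqEcard sub.
have /eqP E2 : e' == cover S by rewrite eqEcard sub //= (ce e' e'S) -(ce e eS).
by move: ee'; rewrite E1 -E2 eqxx.
Qed.

Lemma m_density_ge (S : {set {set V}}) : S \subset eset H -> (1 < #|S|)%N ->
  (#|S|%:R - 1) / (#|cover S|%:R - l%:R) <= m_density R H.
Proof.
move=> SH S1.
have ok : [forall e in (cover S, S).2, (e \subset (cover S, S).1) && (#|e| == l)].
  apply/forallP => e; apply/implyP => /= eS.
  rewrite (card_edge (G := H)) ?eqxx ?andbT ?(subsetP SH) //.
  exact: bigcup_sup.
pose H' := LGraph ok.
apply: (@le_bigmax_cond _ _ _ _ H' _ (fun H' : lgraph l V =>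
  ((ne H')%:R - 1) / ((nv H')%:R - l%:R))).
rewrite /subgraph /= SH S1 !andbT; apply/bigcupsP => e eS.
by apply: (edge_sub (G := H)); apply: (subsetP SH).
Qed.

Hypothesis H2 : (2 <= ne H)%N.

(** The subgraph formed by two edges covers at most [2 * l] vertices. *)
Lemma inv_m_density_le : 0 < m_density R H /\ (m_density R H)^-1 <= l%:R.
Proof.
have [e [e' [eH e'H ee']]] := card_gt1P H2.
pose S := [set e; e'].
have SH : S \subset eset H by apply/subsetP => x; rewrite !inE => /orP[] /eqP ->.
have S2 : #|S| = 2%N by rewrite cards2 ee'.
have S1 : (1 < #|S|)%N by rewrite S2.
have sp := cover_gt SH S1; have := m_density_ge SH S1.
have sp2 : (#|cover S| <= l + l)%N.
  have -> : cover S = e :|: e' by rewrite /cover bigcup_setU !big_set1.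
  by rewrite cardsU (card_edge eH) (card_edge e'H) leq_subr.
rewrite S2; have -> : 2 - 1 = 1 :> R by lra.
have d0 : 0 < #|cover S|%:R - l%:R :> R by rewrite subr_gt0 ltr_nat.
have d1 : #|cover S|%:R - l%:R <= l%:R :> R by rewrite lerBlDr -natrD ler_nat.
move=> h; have m0 : 0 < m_density R H by apply: lt_le_trans h; rewrite divr_gt0.
split=> //; apply: le_trans d1.
by rewrite -[leRHS]invrK lef_pV2 ?posrE ?invr_gt0 // -div1r.
Qed.

(** The only place where the density enters: [j] edges of [H] cover at least
    [l + (j - 1) / m] vertices. For [j = 1] this is an equality. *)
Lemma cover_density (S : {set {set V}}) : S \subset eset H -> (0 < #|S|)%N ->
  (#|S|%:R - 1) / m_density R H <= #|cover S|%:R - l%:R.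
Proof.
move=> SH S0; have [S1|S1] := leqP #|S| 1.
  have {S0}S1 : #|S| = 1%N by apply/eqP; rewrite eqn_leq S1.
  have [e Se] := cards1P (introT eqP S1).
  rewrite S1 subrr mul0r subr_ge0 ler_nat Se /cover big_set1.
  by rewrite (card_edge (G := H)) // (subsetP SH) // Se inE.
have [m0 _] := inv_m_density_le.
have d0 : 0 < #|cover S|%:R - l%:R :> R by rewrite subr_gt0 ltr_nat cover_gt.
rewrite ler_pdivrMr // mulrC -ler_pdivrMr //; exact: m_density_ge.
Qed.

Local Notation W := {x : V | x \in vset H}.

(** The hypergraph whose vertices are the [l]-sets and whose edges are the edge
    sets of copies of [H], an edge being weighted by its number of embeddings. *)
Definition embedding_weight (T : finType) (e : {set {set T}}) : R :=
  #|[set f : {ffun W -> T} | injectiveb f & image_edges f == e]|%:R.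

Lemma sum_embedding_weight (T : finType) (P : pred {set {set T}}) :
  \sum_(e | P e) embedding_weight e =
  #|[set f : {ffun W -> T} | injectiveb f & P (image_edges f)]|%:R.
Proof.
rewrite /embedding_weight -natr_sum; congr (_%:R); rewrite -[RHS]sum1_card.
rewrite (partition_big (@image_edges _ _ H T) P) /= => [|f]; last first.
  by rewrite inE => /andP[].
apply: eq_bigr => e Pe; rewrite -sum1_card; apply: eq_bigl => f.
by rewrite !inE; case: eqP => [->|]; rewrite ?Pe ?andbF ?andbT.
Qed.

Lemma deg_within_embedding_weight (T : finType) (C : {set {set T}}) :
  deg (weight_within (@embedding_weight T) C) set0 = #|embeddings H C|%:R.
Proof.
by rewrite deg0E -(sum_embedding_weight (fun e => e \subset C)) [RHS]big_mkcond.
Qed.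

(** Hence the hypergraph of copies is spread with [p = N `^ (- m^-1)]: a set of
    [j] edges lies in at most [K * N `^ (nv H - l - (j - 1) / m)] embeddings. *)
Lemma deg_embedding_weight (N : nat) (s : {set {set 'I_N}}) (m := m_density R H)
    (K : R := (2 ^ ne H * nv H ^ nv H)%:R) :
  (0 < N)%N -> s != set0 ->
  deg (@embedding_weight 'I_N) s <=
    K * N%:R `^ ((nv H)%:R - (l%:R - m^-1)) * (N%:R `^ (- m^-1)) ^+ #|s|.
Proof.
move=> N0 s0; rewrite /deg (sum_embedding_weight (fun e => s \subset e)).
have [m0 _] := inv_m_density_le; rewrite -/m in m0.
have N1 : 1 <= N%:R :> R by rewrite ler1n.
have Nn0 : N%:R != 0 :> R by rewrite pnatr_eq0 -lt0n.
rewrite -powR_mulrn ?powR_ge0 // -powRrM -mulrA -powRD ?Nn0 ?implybT //.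
set y := N%:R `^ _.
have y0 : 0 <= y by exact: powR_ge0.
have := @codegree_bound l V H 'I_N s (Num.truncn y); rewrite card_ord mulnA.
move=> bnd; apply: (@le_trans _ _ (K * (Num.truncn y)%:R)); last first.
  by apply: ler_wpM2l; rewrite ?ler0n // truncn_le.
rewrite /K -natrM ler_nat; apply: bnd => S SH Ss.
have sv : (#|cover S| <= nv H)%N.
  apply: subset_leq_card; apply/bigcupsP => e eS.
  by apply: (edge_sub (G := H)); apply: (subsetP SH).
rewrite truncn_ge_nat // natrX -powR_mulrn // /y; apply: ler_powR => //.
rewrite natrB //.
have := cover_density SH; rewrite Ss card_gt0 => /(_ s0); rewrite -/m => h.
have -> : - m^-1 * #|s|%:R = - ((#|s|%:R - 1) / m) - m^-1 by ring.
lra.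
Qed.
End Density.

(** * Counting containers *)

Lemma bin_le_expn (n k : nat) : ('C(n, k) <= n ^ k)%N.
Proof.
apply: (@leq_trans (n ^_ k)); first by rewrite -bin_ffact leq_pmulr // fact_gt0.
rewrite ffact_prod -[X in (_ ^ X)%N](card_ord k) -prod_nat_const.
by apply: leq_prod => j _; rewrite leq_subr.
Qed.

Lemma card_small_subsets (T : finType) (U : {set T}) q :
  (#|[set A : {set T} | (A \subset U) && (#|A| <= q)%N]| <= (#|U| + 1) ^ q)%N.
Proof.
rewrite Pascal.
apply: (@leq_trans (\sum_(i < q.+1) 'C(#|U|, i))).
  rewrite -sum1_card (partition_big (fun A : {set T} => inord #|A| : 'I_q.+1) predT) //=.
  apply: leq_sum => i _; rewrite sum1dep_card -cards_draws.
  apply: subset_leq_card; apply/subsetP => A; rewrite !inE => /andP[/andP[-> Aq] /eqP <-].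
  by rewrite inordK ?eqxx //=.
rewrite (reindex_inj rev_ord_inj) /=; apply: leq_sum => i _; rewrite subSS exp1n muln1.
have iq : (i <= q)%N by rewrite -ltnS.
apply: leq_trans (leq_pmull _ _); last by rewrite bin_gt0.
exact: bin_le_expn.
Qed.

Lemma card_seq_image (X Y : finType) (A : {set X}) (h : seq X -> Y)
    (S : nat) (x0 : X) :
  exists CC : {set Y}, (#|CC| <= #|A| ^ S)%N /\
  forall T, size T = S -> {subset T <= A} -> h T \in CC.
Proof.
exists [set h [seq f i | i <- enum 'I_S] |
    f : {ffun 'I_S -> X} in ffun_on (mem A)].
split; first by apply: leq_trans (leq_imset_card _ _) _; rewrite card_ffun_on card_ord.
move=> T sT TA; apply/imsetP; exists [ffun i : 'I_S => nth x0 T i].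
  by apply/ffun_onP => i; rewrite ffunE; apply/TA/mem_nth; rewrite sT.
congr h; rewrite -{1}(mkseq_nth x0 T) sT /mkseq -val_enum_ord -map_comp.
by apply: eq_map => i; rewrite /= ffunE.
Qed.

Section Restrict.
Variables (l N : nat).
Definition edges_of_size : {set {set 'I_N}} := [set e : {set 'I_N} | #|e| == l].

Lemma graph_of_edges_subproof (E : {set {set 'I_N}}) :
  [forall e in ([set: 'I_N], E :&: edges_of_size).2,
    (e \subset ([set: 'I_N], E :&: edges_of_size).1) && (#|e| == l)].
Proof. by apply/forallP => e; apply/implyP; rewrite !inE subsetT => /andP[]. Qed.

(** Intersecting with the [l]-sets makes this total, as a container function
    has to be. *)
Definition graph_of_edges (E : {set {set 'I_N}}) : lgraph_on l N :=
  exist (fun G : lgraph l 'I_N => vset G == [set: 'I_N])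
    (LGraph (graph_of_edges_subproof E)) (eqxx _).

Lemma eset_graph_of_edges (E : {set {set 'I_N}}) : E \subset edges_of_size ->
  eset (lgraph_of (graph_of_edges E)) = E.
Proof. by move=> /setIidPl. Qed.

Lemma eset_sub (G : lgraph_on l N) : eset (lgraph_of G) \subset edges_of_size.
Proof. by apply/subsetP => e /card_edge /eqP; rewrite inE. Qed.

Lemma vset_full (G : lgraph_on l N) : vset (lgraph_of G) = [set: 'I_N].
Proof. by apply/eqP; apply: (svalP G). Qed.
End Restrict.

(** * Containers for graphs without a given subgraph *)

Theorem theorem2p3 (R : realType) (l : nat) (V : finType) (H : lgraph l V)
    (eps : R) :
  (2 <= ne H)%N -> 0 < eps ->
  exists2 c : R, 0 < c &
  forall N : nat, c <= N%:R ->
  exists (CC : {set lgraph_on l N})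
         (container : seq (lgraph_on l N) -> lgraph_on l N),
  [/\ (* (a) and (d) *)
      forall I : lgraph_on l N, graph_free H I ->
        exists C : lgraph_on l N,
          [/\ C \in CC, subgraph I C &
              exists T : seq (lgraph_on l N),
                [/\ forall Ti : lgraph_on l N, Ti \in T -> subgraph Ti I,
                    (size T)%:R <= c,
                    (\sum_(Ti <- T) ne Ti)%:R
                      <= c * N%:R `^ (l%:R - (m_density R H)^-1) &
                    C = container T]],
      (* (b) *)
      forall C : lgraph_on l N, C \in CC ->
        #|copies H C|%:R <= eps * N%:R ^+ nv H /\
        (ne C)%:R <= (turan_density R H + eps) * 'C(N, l)%:R &
      (* (c) *)
      ln #|CC|%:R <= c * N%:R `^ (l%:R - (m_density R H)^-1) * ln N%:R].
Proof.
move=> H2 e0; have [gamma g0 [N0 sparse]] := few_embeddings_sparse H e0.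
have [m0 ml] := inv_m_density_le R H2; set m := m_density R H in m0 ml *.
set v := nv H; pose K : R := (2 ^ ne H * v ^ v)%:R.
have K0 : 0 < K by rewrite ltr0n muln_gt0 !expn_gt0 /=; case: (v).
(* Few enough embeddings both for the bound on copies and for sparseness. *)
pose e1 := Num.min eps gamma; have e10 : 0 < e1 by rewrite lt_min e0.
have alpha0 : 0 < e1 / K by rewrite divr_gt0.
have [S [p0 [p00 cont]]] := hypergraph_containers (ne H) alpha0.
(* The third bound makes p at most p0, the last one absorbs the factor
   ln (N ^ l + 1) <= l.+1 * ln N in the count of containers. *)
have [c [c2 cN0 cp0 cS cSl]] : exists c : R,
    [/\ 2 <= c, N0%:R <= c, p0^-1 `^ m <= c, S%:R <= c & 2 * S%:R * l.+1%:R <= c].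
  suff bound (a b x y : R) : exists c : R, [/\ 2 <= c, a <= c, b <= c, x <= c & y <= c].
    exact: bound.
  exists (Num.max 2 (Num.max a (Num.max b (Num.max x y)))).
  by rewrite !le_max !lexx !orbT.
have c0 : 0 <= c by exact: le_trans c2.
have cS2 : 2 * S%:R <= c.
  by apply: le_trans cSl; rewrite ler_peMr ?mulr_ge0 // ler1n.
exists c; first exact: lt_le_trans c2.
move=> N cN; set n : R := N%:R ^+ l; set p := N%:R `^ (- m^-1) : R.
set Q := N%:R `^ _.
have N2 : (2 <= N)%N by rewrite -(ler_nat R); apply: le_trans cN.
have Ngt0 : 0 < N%:R :> R by rewrite ltr0n (leq_trans _ N2).
have Nneq0 : N%:R != 0 :> R by rewrite gt_eqF.
have N1 : 1 <= N%:R :> R by rewrite ler1n (leq_trans _ N2).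
have NN0 : (N0 <= N)%N by rewrite -(ler_nat R); apply: le_trans cN.
have pn : p * n = Q.
  by rewrite /p /n -powR_mulrn // -powRD ?Nneq0 ?implybT // /Q addrC.
have Q1 : 1 <= Q.
  by rewrite -(powRr0 N%:R); apply: ler_powR => //; rewrite subr_ge0.
have p_gt0 : 0 < p by exact: powR_gt0.
have pp0 : p <= p0.
  have Np : p0^-1 `^ m <= N%:R by apply: le_trans cN.
  have : p0^-1 <= N%:R `^ m^-1.
    have -> : p0^-1 = (p0^-1 `^ m) `^ m^-1.
      by rewrite -powRrM mulfV ?gt_eqF // powRr1 // invr_ge0 ltW.
    have m1 : 0 <= m^-1 by rewrite invr_ge0 ltW.
    apply: (ge0_ler_powR m1 _ _ Np); rewrite nnegrE; [exact: powR_ge0|exact: ler0n].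
  rewrite /p powRN => h; rewrite -[leRHS]invrK lef_pV2 // posrE ?invr_gt0 //.
  exact: powR_gt0.
(* The value of B for which B * p * n is K times the number of maps. *)
pose B := K * N%:R `^ (v%:R - (l%:R - m^-1)).
have B0 : 0 < B by rewrite mulr_gt0 // powR_gt0.
have Bpn : e1 / K * (B * p * n) = e1 * N%:R ^+ v.
  have -> : B * p * n = K * N%:R ^+ v.
    rewrite -mulrA pn /B -mulrA -powRD ?Nneq0 ?implybT //.
    by rewrite subrK powR_mulrn.
  by rewrite mulrA divfK ?gt_eqF.
pose U := edges_of_size l N.
have Un : #|U|%:R <= n.
  by rewrite /n -natrX ler_nat card_draws card_ord; apply: bin_le_expn.
have [||||||cf cfP] := cont _ U n p B (@embedding_weight R l V H _) Un.
- by rewrite p_gt0.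
- by rewrite pn.
- exact: B0.
- by move=> e; rewrite ler0n.
- move=> e; rewrite ltr0n => /card_gt0P[f]; rewrite inE => /andP[/injectiveP fi /eqP <-].
  exact: card_image_edges.
- by move=> s s0; apply: deg_embedding_weight => //; apply: leq_trans N2.
pose q := Num.truncn (2 * Q).
have q0 : 0 <= 2 * Q by rewrite mulr_ge0 // (le_trans ler01).
pose small := [set A : {set {set 'I_N}} | (A \subset U) && (#|A| <= q)%N].
pose mk := @graph_of_edges l N.
have [CC0 [CC0n CC0P]] := card_seq_image small (fun T => mk (cf T)) S set0.
(* Tuples that are not fingerprints may give a dense graph; discard those. *)
pose CC :=
  [set C in CC0 | #|embeddings H (eset (lgraph_of C))|%:R <= e1 * N%:R ^+ v].
exists CC, (fun T => mk (cf [seq eset (lgraph_of G) | G <- T])); split.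
- move=> I Ifree.
  have emb0 := embeddings_graph_free (vset_full I) Ifree.
  have [|T [sT TI IT TU Tfew]] := cfP (eset (lgraph_of I)) (eset_sub I).
    move=> e eI; rewrite ltr0n => /card_gt0P[f].
    rewrite inE => /andP[fi /eqP fe].
    have : f \in embeddings H (eset (lgraph_of I)) by rewrite inE fi fe.
    by rewrite emb0 inE.
  rewrite pn in TI; rewrite deg_within_embedding_weight Bpn in Tfew.
  have mkE F : F \in T -> eset (lgraph_of (mk F)) = F.
    move=> FT; apply: eset_graph_of_edges.
    by apply: subset_trans (eset_sub I); case: (TI F FT).
  have mkT : [seq eset (lgraph_of G) | G <- [seq mk F | F <- T]] = T.
    by rewrite -map_comp -[RHS]map_id; apply/eq_in_map => F /mkE.
  exists (mk (cf T)); split.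
  + rewrite inE eset_graph_of_edges // Tfew andbT; apply: CC0P => // F FT.
    have [FI Fq] := TI F FT.
    by rewrite inE (subset_trans FI (eset_sub I)) truncn_ge_nat.
  + by rewrite /subgraph !vset_full subxx eset_graph_of_edges.
  exists [seq mk F | F <- T]; split.
  + move=> _ /mapP[F FT ->]; rewrite /subgraph !vset_full subxx mkE //.
    by case: (TI F FT).
  + by rewrite size_map sT.
  + rewrite natr_sum big_map; apply: (@le_trans _ _ (\sum_(F <- T) 2 * Q)).
      rewrite big_seq [leRHS]big_seq; apply: ler_sum => F FT.
      by rewrite /ne mkE //; case: (TI F FT).
    rewrite big_const_seq count_predT sT iter_addr_0 -[leLHS]mulr_natl.
    by rewrite mulrA [_ * 2]mulrC ler_wpM2r // (le_trans ler01).
  + by rewrite mkT.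
- move=> C; rewrite inE => /andP[_ Cfew]; split.
    apply: (@le_trans _ _ #|embeddings H (eset (lgraph_of C))|%:R).
      by rewrite ler_nat copies_le_embeddings.
    by apply: le_trans Cfew _; rewrite ler_wpM2r ?exprn_ge0 // ge_min lexx.
  have := sparse 'I_N (eset (lgraph_of C)); rewrite card_ord; apply => // [e|].
    exact: card_edge.
  by apply: le_trans Cfew _; rewrite ler_wpM2r ?exprn_ge0 // ge_min lexx orbT.
have lnN : 0 <= ln N%:R :> R by exact: ln_ge0.
have [CC00|CC00] := posnP #|CC|.
  by rewrite CC00 ln0 ?lexx // !mulr_ge0 // (le_trans ler01).
have CCb : (#|CC| <= N ^ (l.+1 * q * S))%N.
  apply: (@leq_trans #|CC0|).
    by apply: subset_leq_card; apply/subsetP => C; rewrite inE => /andP[].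
  apply: leq_trans CC0n _; rewrite expnM.
  have [->|S_gt0] := posnP S; first by rewrite !expn0.
  rewrite leq_exp2r //; apply: leq_trans (card_small_subsets U q) _.
  rewrite expnM; have [->|q_gt0] := posnP q; first by rewrite !expn0.
  rewrite leq_exp2r //.
  have UN : (#|U| <= N ^ l)%N by rewrite card_draws card_ord bin_le_expn.
  apply: (@leq_trans (N ^ l + N ^ l)).
    by rewrite leq_add // expn_gt0 (leq_trans _ N2).
  by rewrite addnn -mul2n expnS leq_mul2r N2 orbT.
apply: (@le_trans _ _ (ln (N ^ (l.+1 * q * S))%:R)).
  by rewrite ler_ln ?posrE ?ltr0n ?expn_gt0 ?(leq_trans _ N2) // ler_nat.
rewrite natrX lnXn // -[leLHS]mulr_natl; apply: ler_wpM2r => //.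
apply: (@le_trans _ _ (2 * S%:R * l.+1%:R * Q)); last first.
  by rewrite ler_wpM2r // (le_trans ler01).
have -> : 2 * S%:R * l.+1%:R * Q = l.+1%:R * (2 * Q) * S%:R by ring.
rewrite !natrM; apply: ler_wpM2r => //; apply: ler_wpM2l => //.
by rewrite truncn_le.
Qed.
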